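(* There does not exist any complex equiangular $(8,3)$-frame, and there does not exist any complex equiangular $(8,5)$-frame.
   Context: For integers $n\ge m\ge 1$ (with $n\geq 2$), a complex equiangular tight frame, or complex equiangular $(n,m)$-frame, is a collection of $n$ unit vectors $\varphi_1,\dots,\varphi_n\in\mathbb{C}^m$ such that $|\langle\varphi_i,\varphi_j\rangle|=\alpha_{n,m}:=\sqrt{\frac{n-m}{m(n-1)}}$ for all $1\le i<j\le n$, and which is tight: the $m\times n$ matrix $F$ with columns $\varphi_1,\dots,\varphi_n$ has pairwise orthogonal rows of equal norm, i.e. $FF^\ast=\frac{n}{m}I_m$. *)

(* Defs.v *)
From mathcomp Require Import all_boot all_order all_algebra.
From mathcomp Require Import reals complex.

Set Implicit Arguments.
Unset Strict Implicit.
Unset Printing Implicit Defensive.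

Import Order.TTheory GRing.Theory Num.Theory.
Local Open Scope ring_scope.
Local Open Scope complex_scope.
Local Open Scope sesquilinear_scope.

Section EquiangularTightFrames.
Variable R : realType.

(* The library's [dotmx] is stated for row vectors, hence the transposes; it is
   linear in [u] and conjugate-linear in [v]. *)
Definition cvdot (m : nat) (u v : 'cV[R[i]]_m) : R[i] := dotmx u^T v^T.

Definition cvnorm (m : nat) (u : 'cV[R[i]]_m) : R[i] := sqrtC (cvdot u u).

Definition frame_mx (n m : nat) (phi : 'I_n -> 'cV[R[i]]_m) :
  'M[R[i]]_(m, n) := \matrix_(k < m, j < n) phi j k 0.

(* The subtractions are in [R], not truncated on [nat]. *)
Definition welch_angle (n m : nat) : R :=
  Num.sqrt ((n%:R - m%:R) / (m%:R * (n%:R - 1))).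

(* The first two clauses are the standing assumptions on the parameters. *)
Definition equiangular_frame (n m : nat) (phi : 'I_n -> 'cV[R[i]]_m) : Prop :=
  [/\ (2 <= n)%N, (1 <= m <= n)%N,
      forall j, cvnorm (phi j) = 1,
      forall j k : 'I_n, (j < k)%N ->
        `|cvdot (phi j) (phi k)| = (welch_angle n m)%:C
    & frame_mx phi *m (frame_mx phi)^t* = (n%:R / m%:R)%:M].

End EquiangularTightFrames.

(* Main.v *)
Require Import Defs.
From mathcomp Require Import all_boot all_order all_algebra.
From mathcomp Require Import reals complex ring.
Set Implicit Arguments.
Unset Strict Implicit.
Unset Printing Implicit Defensive.
Import Order.TTheory GRing.Theory Num.Theory.
Local Open Scope ring_scope.

(** The pairs (n, m) = (8, 3) and (8, 5) are the cases d = 3 of (d^2 - 1, d)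
    and of its Naimark complement (d^2 - 1, d^2 - 1 - d), and the obstruction
    exists for every d >= 3.

    Let phi_1, ..., phi_n be an equiangular tight frame of C^d with
    n = d^2 - 1, and let Phi_k be the rank one projection on phi_k.  For j <> k
    the number tr (Phi_j Phi_k) is a constant beta, so the Phi_k are linearly
    independent and span a hyperplane of the d^2-dimensional space of matrices;
    its orthogonal for the form tr (A B) is a line spanned by some X, and tr X
    = 0 because the Phi_k sum to a multiple of the identity.  Decomposing a
    matrix A along the Phi_k and X, and using tightness, one finds
      sum_j tr (A Phi_j) Phi_j
        = (1 - beta) A + beta (n/d) tr(A) I - lambda(A) X
    for some linear form lambda.  With A an elementary matrix, the entries of
    the left-hand side are sums of products of four coordinates of phi_j, and
    they are unchanged when two indices of the same kind (both conjugated, or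
    both not conjugated) are exchanged.  On the right-hand side the first two
    terms do not have this symmetry, so lambda (x) X must make up for it: with
    kappa = 1 - beta - beta n/d, which is nonzero, the 2 x 2 minors of X are
    those of a scalar matrix, up to a nonzero constant.  When d >= 3 this
    forces X itself to be a nonzero scalar matrix, and then tr X <> 0.
    The case d = 2 escapes, since there a single minor is constrained.

    The argument is purely bilinear: it is carried out for a factorization
    U V of the Gram matrix, in which V need not be the adjoint of U, so that
    tr (Z Phi_k) is the k-th diagonal entry of U Z V.
    [sandwich_kernel_line] provides X, [scalar_of_swap_tensor] is the algebra
    of minors, and [no_equiangular_gram] combines them.  Since any rank
    factorization will do, the complementary frame need not be built: a
    multiple of the complementary projection 1 - (m/n) F^* F satisfies the
    hypotheses of [no_equiangular_projection]. *)

(** * The orthogonal of the rank one matrices of a frame *)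

(** Turns the conditions (U Z V)_kk = 0 on a matrix Z into one linear system,
    so that their solutions can be counted by a rank computation. *)
Lemma mulmx_sandwich_mxvec (F : fieldType) (n d : nat)
    (U : 'M[F]_(n, d)) (V : 'M[F]_(d, n)) (Z : 'M[F]_d) (k : 'I_n) :
  ((\matrix_k mxvec ((row k U)^T *m (col k V)^T)) *m (mxvec Z)^T) k 0 =
  (U *m Z *m V) k k.
Proof.
have -> : forall (M : 'M[F]_(n, d * d)) (v : 'cV[F]_(d * d)),
    (M *m v) k 0 = (row k M *m v) 0 0 by move=> M v; rewrite -row_mul [RHS]mxE.
by rewrite rowK mxvec_dotmul trmxK colE mulmxA -!row_mul -colE !mxE.
Qed.

Lemma row_free_equiangular_gram (F : fieldType) (n : nat) (beta : F)
    (K : 'M[F]_n) :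
  1 - beta != 0 -> 1 + (n%:R - 1) * beta != 0 ->
  (forall k, K k k = 1) -> (forall j k, j != k -> K j k = beta) ->
  row_free K.
Proof.
move=> b1 bn Kd Ko; apply: inj_row_free => v vK0.
have vKE k : (1 - beta) * v 0 k + beta * \sum_j v 0 j = 0.
  have := congr1 (fun w : 'rV_n => w 0 k) vK0; rewrite !mxE => vKk.
  rewrite -[RHS]vKk mulr_sumr (bigD1 k) //= [RHS](bigD1 k) //= Kd addrA -mulrDl.
  rewrite subrK mulrC; congr (_ + _); apply: eq_bigr => j njk.
  by rewrite Ko // mulrC.
have s0 : \sum_j v 0 j = 0.
  have : \sum_k ((1 - beta) * v 0 k + beta * \sum_j v 0 j) = 0.
    by apply: big1 => k _.
  rewrite big_split /= -mulr_sumr sumr_const card_ord => sum0.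
  by apply: (mulfI bn); rewrite mulr0 -[RHS]sum0 -mulr_natl; ring.
apply/rowP => k; rewrite mxE; apply/eqP; have := vKE k.
by rewrite s0 mulr0 addr0 => /eqP; rewrite mulf_eq0 (negPf b1).
Qed.

(** The n linear forms Z |-> (U Z V)_kk are independent, because pairing them
    with the n rank one matrices (column k of V)(row k of U) gives the
    invertible matrix with diagonal 1 and all other entries beta.  Hence their
    common kernel has dimension d^2 - n = 1. *)
Lemma sandwich_kernel_line (F : fieldType) (n d : nat) (beta : F)
    (U : 'M[F]_(n, d)) (V : 'M[F]_(d, n)) :
  (d * d = n.+1)%N -> 1 - beta != 0 -> 1 + (n%:R - 1) * beta != 0 ->
  (forall k, (U *m V) k k = 1) ->
  (forall j k, j != k -> (U *m V) j k * (U *m V) k j = beta) ->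
  exists2 X : 'M[F]_d, (forall k, (U *m X *m V) k k = 0) &
    forall Z : 'M[F]_d, (forall k, (U *m Z *m V) k k = 0) ->
      exists c, Z = c *: X.
Proof.
move=> ddn b1 bn Pd Po.
pose M : 'M[F]_(n, d * d) := \matrix_k mxvec ((row k U)^T *m (col k V)^T).
have rM : \rank M = n.
  pose N : 'M[F]_(n, d * d) := \matrix_k mxvec (col k V *m row k U).
  have MN j k : (M *m N^T) j k = (U *m V) j k * (U *m V) k j.
    have -> : (M *m N^T) j k = (M *m (mxvec (col k V *m row k U))^T) j 0.
      by rewrite !mxE; apply: eq_bigr => i _; rewrite !mxE.
    rewrite mulmx_sandwich_mxvec mulmxA -mulmxA colE (mulmxA U) -colE -row_mul.
    by rewrite mxE big_ord1 !mxE.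
  have : row_free (M *m N^T).
    apply: (row_free_equiangular_gram b1 bn) => [k|j k njk].
      by rewrite MN Pd mulr1.
    by rewrite MN Po.
  rewrite /row_free => /eqP rMN; apply/eqP.
  by rewrite eqn_leq rank_leq_row -{1}rMN mxrankM_maxl.
have rk : \rank (kermx M^T) = 1%N.
  by rewrite mxrank_ker mxrank_tr rM ddn subSnn.
have inK (Z : 'M[F]_d) :
    (mxvec Z <= kermx M^T)%MS <-> forall k, (U *m Z *m V) k k = 0.
  split=> [/sub_kermxP ZM k|ZM].
    rewrite -mulmx_sandwich_mxvec -/M.
    by rewrite -[_ *m _]trmxK trmx_mul trmxK ZM !mxE.
  apply/sub_kermxP/trmx_inj; rewrite trmx_mul trmxK trmx0.
  by apply/colP => k; rewrite mulmx_sandwich_mxvec ZM mxE.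
have [x xk /eqP x1] : exists2 x : 'rV_(d * d),
    (x <= kermx M^T)%MS & \rank x == 1%N.
  exists (nz_row (kermx M^T)); first exact: nz_row_sub.
  by rewrite rank_rV nz_row_eq0 -mxrank_eq0 rk.
have /eqmxP eqx : (x == kermx M^T)%MS.
  by rewrite -(geq_leqif (mxrank_leqif_eq xk)) x1 rk.
exists (vec_mx x) => [|Z /inK]; first by apply/inK; rewrite vec_mxK.
rewrite -eqx => /sub_rVP [c Zc].
by exists c; apply: (can_inj mxvecK); rewrite linearZ /= vec_mxK.
Qed.

(** * Matrices whose minors are those of a scalar matrix *)

(** The first hypothesis exchanges the row index of [X] with the column index
    of [y], the second one the column index of [X] with the row index of [y].
    Once [X] is diagonal, the first reads y_cc X_aa = - kappa for all a <> c,
    and a third index c, available since 2 < d, compares X_aa and X_bb. *)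
Lemma scalar_of_swap_tensor (F : fieldType) (d : nat) (kappa : F)
    (X y : 'M[F]_d) :
  (2 < d)%N -> kappa != 0 ->
  (forall a b c e, y e c * X a b - y e a * X c b =
     kappa * ((e == a)%:R * (c == b)%:R - (e == c)%:R * (a == b)%:R)) ->
  (forall a b c e, y e c * X a b - y b c * X a e =
     kappa * ((e == a)%:R * (c == b)%:R - (e == c)%:R * (a == b)%:R)) ->
  exists2 x : F, x != 0 & X = x%:M.
Proof.
move=> d3 k0 rows cols.
have third (a b : 'I_d) : exists2 c, c != a & c != b.
  have : (0 < #|~: [set a; b]|)%N.
    rewrite cardsCs setCK cards2 card_ord subn_gt0.
    by apply: leq_trans d3; case: (a != b).
  by case/card_gt0P => c; rewrite !inE negb_or => /andP[]; exists c.
have off a b : a != b -> X a b = 0.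
  move=> ab; have [c ca cb] := third a b.
  (* The first instance expresses kappa through a and c alone.  The three others
     have right-hand side 0, a, b, c being distinct, and combine to cancel
     kappa X_ab. *)
  have h1 := cols a c c a; have h2 := cols a c a a.
  have h3 := rows a b c a; have h4 := rows a b c c.
  move: h1 h2 h3 h4.
  rewrite !eqxx !(eq_sym _ c) (negPf ca) (negPf cb) (negPf ab) => h1 h2 h3 h4.
  apply: (mulfI k0); rewrite mulr0.
  have -> : kappa = y a c * X a c - y c c * X a a by rewrite h1 /=; ring.
  transitivity (X a c * (y a c * X a b - y a a * X c b)
    - X a a * (y c c * X a b - y c a * X c b)
    + X c b * (y a a * X a c - y c a * X a a)); first by ring.
  by rewrite h2 h3 h4 /=; ring.
have diag a c : a != c -> y c c * X a a = - kappa.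
  move=> ac; have := rows a a c c.
  have ca : c != a by rewrite eq_sym.
  rewrite !eqxx (off c a ca) (negPf ca) => h.
  by rewrite -[LHS]subr0 -(mulr0 (y c a)) h /=; ring.
have d0 : (0 < d)%N by apply: leq_trans d3.
pose o := Ordinal d0.
have nz a : X a a != 0.
  have [c ca _] := third a a; apply: contra_neq k0 => Xa.
  by apply: oppr_inj; rewrite -(diag a c) 1?eq_sym // Xa mulr0 oppr0.
exists (X o o) => //; apply/matrixP => a b; rewrite mxE.
have [<-{b}|ab] := eqVneq a b; last by rewrite off.
have [c ca co] := third a o.
have yc : y c c != 0.
  apply: contra_neq k0 => y0.
  by apply: oppr_inj; rewrite -(diag a c) 1?eq_sym // y0 mul0r oppr0.
by apply: (mulfI yc); rewrite !diag // eq_sym.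
Qed.

(** * Equiangular Gram matrices of size d^2 - 1 and rank d *)

(** [Z e c] below is 1 - beta times the X-component of the elementary matrix with
    entry (e, c), as in the expansion of A given above; it is shown to lie in
    the line of X by checking that the diagonal of U Z V vanishes. *)
Lemma no_equiangular_gram (F : numFieldType) (n d : nat) (beta : F)
    (U : 'M[F]_(n, d)) (V : 'M[F]_(d, n)) :
  (d * d = n.+1)%N -> (2 < d)%N -> V *m U = (n%:R / d%:R)%:M ->
  (forall k, (U *m V) k k = 1) ->
  (forall j k, j != k -> (U *m V) j k * (U *m V) k j = beta) -> False.
Proof.
move=> ddn d3 VU Pd Po.
have d0 : d%:R != 0 :> F by rewrite pnatr_eq0 -lt0n; apply: leq_trans d3.
have n2 : (2 < n)%N by rewrite -ltnS -ddn; apply: leq_trans (leq_mul d3 d3).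
have n0 : n%:R != 0 :> F by rewrite pnatr_eq0 -lt0n; apply: leq_trans n2.
have n1 : n%:R - 1 != 0 :> F.
  by rewrite subr_eq0 pnatr_eq1; case: n n2 {U V VU Pd Po ddn n0} => [|[]].
have ddF : d%:R * d%:R = n%:R + 1 :> F by rewrite -natrM ddn -addn1 natrD.
pose r : F := n%:R / d%:R.
have k0 : 'I_n by exists 0%N; apply: leq_trans n2.
(* The diagonal of (U V)^2 = r U V determines beta; both 1 - beta and the
   constant kappa = 1 - beta - beta r are then explicit rational functions. *)
have welch : 1 + (n%:R - 1) * beta = r.
  have : ((U *m V) *m (U *m V)) k0 k0 = r.
    rewrite mulmxA -(mulmxA U) VU mul_mx_scalar -scalemxAl mxE Pd mulr1 //.
  rewrite mxE (bigD1 k0) //= Pd mulr1 => <-; congr (_ + _).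
  rewrite (eq_bigr (fun=> beta)) => [|j jk]; last by rewrite Po // eq_sym.
  rewrite sumr_const cardC1 card_ord -[in RHS]mulr_natl; congr (_ * _).
  by rewrite -subn1 natrB //; apply: leq_trans n2.
have dr : d%:R * r = n%:R by rewrite mulrC divfK.
have b1 : 1 - beta != 0.
  have : d%:R * ((n%:R - 1) * (1 - beta)) = n%:R * (d%:R - 1).
    by rewrite mulrBr mulr1 -[(n%:R - 1) * beta](addKr 1) welch -dr; ring.
  apply: contra_eq_neq => ->; rewrite !mulr0 eq_sym mulf_neq0 //.
  rewrite subr_eq0 pnatr_eq1.
  by case: d d3 {U V VU Pd Po ddn d0 ddF r dr welch} => [|[]].
have kap0 : 1 - beta - beta * r != 0.
  have : d%:R * d%:R * (n%:R - 1) * (1 - beta - beta * r) = n%:R.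
    transitivity (d%:R * d%:R * (n%:R - 1 - (n%:R - 1) * beta * (1 + r))).
      by ring.
    rewrite -[(n%:R - 1) * beta](addKr 1) welch.
    transitivity (d%:R * d%:R * n%:R - (d%:R * r) * (d%:R * r)); first by ring.
    by rewrite dr ddF; ring.
  by apply: contra_eq_neq => ->; rewrite mulr0 eq_sym.
have bn : 1 + (n%:R - 1) * beta != 0 by rewrite welch mulf_neq0 ?invr_eq0.
have [X X0 line] := sandwich_kernel_line ddn b1 bn Pd Po.
pose D e c : 'rV[F]_n := \row_j (V c j * U j e).
pose Z e c : 'M[F]_d := (1 - beta) *: delta_mx e c
  + (beta * r * (e == c)%:R)%:M - V *m diag_mx (D e c) *m U.
have Z0 e c k : (U *m Z e c *m V) k k = 0.
  have UdV : (U *m delta_mx e c *m V) k k = U k e * V c k.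
    rewrite -(mul_delta_mx (0 : 'I_1)) mulmxA -colE -mulmxA -rowE.
    by rewrite mxE big_ord1 !mxE.
  (* Equiangularity enters here, as (UV)_kj (UV)_jk = beta off the diagonal;
     the term j = k contributes 1 = beta + (1 - beta). *)
  have PDP : (U *m V *m diag_mx (D e c) *m (U *m V)) k k =
      (1 - beta) * (U k e * V c k) + beta * (r * (e == c)%:R).
    have -> : r * (e == c)%:R = \sum_j V c j * U j e.
      have := congr1 (fun A : 'M_d => A c e) VU; rewrite !mxE => ->.
      by rewrite eq_sym mulr_natr.
    transitivity (\sum_j (U *m V) k j * (U *m V) j k * (V c j * U j e)).
      rewrite mul_mx_diag [LHS]mxE; apply: eq_bigr => j _.
      by rewrite [(\matrix_(_, _) _) k j]mxE [D e c 0 j]mxE; ring.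
    rewrite (bigD1 k) //= [in RHS](bigD1 k) //= Pd mulrDr mulr_sumr.
    rewrite (eq_bigr (fun j => beta * (V c j * U j e))) => [|j jk].
      by ring.
    by rewrite Po // eq_sym.
  rewrite /Z mulmxBr mulmxBl mulmxDr mulmxDl -scalemxAr -scalemxAl.
  rewrite mul_mx_scalar -scalemxAl.
  move: UdV PDP (Pd k); rewrite !mulmxA.
  move: (U *m V) (_ *m diag_mx _ *m _ *m _) (_ *m delta_mx _ _ *m _) => P B A.
  by rewrite !mxE => -> -> ->; ring.
have ZE e c a b : Z e c a b = (1 - beta) * ((e == a)%:R * (c == b)%:R)
    + beta * r * ((e == c)%:R * (a == b)%:R)
    - \sum_j V c j * U j e * (V a j * U j b).
  have VDU : (V *m diag_mx (D e c) *m U) a b =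
      \sum_j V c j * U j e * (V a j * U j b).
    rewrite mul_mx_diag mxE; apply: eq_bigr => j _.
    by rewrite !mxE; ring.
  rewrite /Z; move: VDU; move: (_ *m U) => A VDU; rewrite !mxE VDU.
  by rewrite -mulnb natrM (eq_sym a e) (eq_sym b c) -mulr_natr; ring.
have [y yP] : exists y : 'M[F]_d, forall e c, Z e c = y e c *: X.
  have /fin_all_exists[f fP] : forall p : 'I_d * 'I_d,
      exists t, Z p.1 p.2 = t *: X.
    by move=> p; apply: line => k; apply: Z0.
  by exists (\matrix_(e, c) f (e, c)) => e c; rewrite mxE (fP (e, c)).
have yX e c a b : y e c * X a b = Z e c a b by rewrite yP mxE.
have [||x x0 Xx] := scalar_of_swap_tensor (X := X) (y := y) d3 kap0.
- move=> a b c e; rewrite !yX !ZE.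
  have -> : \sum_j V a j * U j e * (V c j * U j b) =
      \sum_j V c j * U j e * (V a j * U j b).
    by apply: eq_bigr => j _; ring.
  by ring.
- move=> a b c e; rewrite !yX !ZE.
  have -> : \sum_j V c j * U j b * (V a j * U j e) =
      \sum_j V c j * U j e * (V a j * U j b).
    by apply: eq_bigr => j _; ring.
  by rewrite (eq_sym b a) (eq_sym b c) (eq_sym a e) (eq_sym c e); ring.
have /eqP := X0 k0.
by rewrite Xx mul_mx_scalar -scalemxAl mxE Pd mulr1 (negPf x0).
Qed.
(** By P^2 = (n/d) P, every factorization of P through its rank d has its
    factors multiplying to (n/d) I in the other order. *)
Lemma no_equiangular_projection (F : numFieldType) (n d : nat) (beta : F)
    (P : 'M[F]_n) :
  (d * d = n.+1)%N -> (2 < d)%N -> \rank P = d ->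
  P *m P = (n%:R / d%:R) *: P -> (forall k, P k k = 1) ->
  (forall j k, j != k -> P j k * P k j = beta) -> False.
Proof.
move=> ddn d3 rP PP Pd Po.
apply: (@no_equiangular_gram F n (\rank P) beta (col_base P) (row_base P)).
- by rewrite rP.
- by rewrite rP.
- apply: (row_full_inj (col_base_full P)).
  apply: (row_free_inj (row_base_free P)).
  have cb := mulmx_base P; move: (col_base P) (row_base P) cb => C B CB.
  by rewrite /= mulmxA CB -mulmxA CB PP mul_mx_scalar -scalemxAl CB rP.
- by move=> k; rewrite mulmx_base.
- by move=> j k; rewrite mulmx_base; apply: Po.
Qed.

(** * Equiangular tight frames *)

Section EquiangularFrames.
Local Open Scope complex_scope.
Local Open Scope sesquilinear_scope.

Lemma frame_gramE (R : realType) (n m : nat) (phi : 'I_n -> 'cV[R[i]]_m) j k :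
  ((frame_mx phi)^t* *m frame_mx phi) j k = cvdot (phi k) (phi j).
Proof.
rewrite /cvdot dotmxE !mxE; apply: eq_bigr => a _; rewrite !mxE.
exact: mulrC.
Qed.

Lemma equiangular_frame_gram (R : realType) (n m : nat)
    (phi : 'I_n -> 'cV[R[i]]_m) :
  equiangular_frame phi ->
  let P := (frame_mx phi)^t* *m frame_mx phi in
  [/\ \rank P = m, P *m P = (n%:R / m%:R) *: P, forall k, P k k = 1 &
    forall j k, j != k -> P j k * P k j = ((welch_angle R n m)%:C) ^+ 2].
Proof.
case=> n2 /andP[m0 mn] nrm ang tight P.
have r0 : n%:R / m%:R != 0 :> R[i].
  by rewrite mulf_neq0 ?invr_eq0 ?pnatr_eq0 -?lt0n // (leq_trans m0).
have PP : P *m P = (n%:R / m%:R) *: P.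
  by rewrite mulmxA -(mulmxA _ (frame_mx phi)) tight mul_mx_scalar -scalemxAl.
split=> //.
- apply/eqP; rewrite eqn_leq (leq_trans (mxrankM_maxr _ _) (rank_leq_row _)) /=.
  have : \rank (frame_mx phi *m P) = \rank (frame_mx phi).
    by rewrite mulmxA tight mul_scalar_mx mxrank_scale_nz.
  have : \rank (frame_mx phi *m (frame_mx phi)^t*) = m.
    by rewrite tight -scalemx1 mxrank_scale_nz // mxrank1.
  move=> rF rFP; rewrite -[X in (X <= _)%N]rF.
  by apply: leq_trans (mxrankM_maxl _ _) _; rewrite -rFP mxrankM_maxr.
- move=> k; rewrite frame_gramE; have := nrm k; rewrite /cvnorm => nk.
  by rewrite -[LHS]sqrtCK nk expr1n.
- have sym (j k : 'I_n) : cvdot (phi j) (phi k) = (cvdot (phi k) (phi j))^*%R.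
    rewrite -!frame_gramE !mxE rmorph_sum; apply: eq_bigr => a _.
    by rewrite !mxE rmorphM /= conjCK mulrC.
  move=> j k jk; rewrite !frame_gramE.
  wlog lt_jk : j k jk / (j < k)%N => [H|].
    case: (ltngtP j k) => [|lt_kj|/val_inj eq_jk]; first exact: H.
      by rewrite mulrC H // eq_sym.
    by rewrite eq_jk eqxx in jk.
  by rewrite -(ang j k lt_jk) normCK -sym mulrC.
Qed.

Lemma no_equiangular_frame (R : realType) (n m : nat)
    (phi : 'I_n -> 'cV[R[i]]_m) :
  (m * m = n.+1)%N -> (2 < m)%N -> ~ equiangular_frame phi.
Proof.
move=> mmn m3 /equiangular_frame_gram [rP PP Pd Po].
exact: (no_equiangular_projection mmn m3 rP PP Pd Po).
Qed.

(** With E = (m/n) F^* F the projection attached to the frame, (n/d) (1 - E)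
    is the Gram matrix of its Naimark complement: it has rank d and unit
    diagonal, and its off-diagonal entries are those of F^* F times - m/d. *)
Lemma no_complementary_equiangular_frame (R : realType) (n m d : nat)
    (phi : 'I_n -> 'cV[R[i]]_m) :
  (m + d = n)%N -> (d * d = n.+1)%N -> (2 < d)%N -> ~ equiangular_frame phi.
Proof.
move=> mdn ddn d3 phiP; have [_ /andP[m0 _] _ _ _] := phiP.
have [rP PP Pd Po] := equiangular_frame_gram phiP.
move: (_ *m _) rP PP Pd Po => P rP PP Pd Po.
have m0C : m%:R != 0 :> R[i] by rewrite pnatr_eq0 -lt0n.
have d0C : d%:R != 0 :> R[i] by rewrite pnatr_eq0 -lt0n; apply: leq_trans d3.
have nC : n%:R = m%:R + d%:R :> R[i] by rewrite -natrD mdn.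
have n0C : m%:R + d%:R != 0 :> R[i].
  by rewrite -natrD pnatr_eq0 addn_eq0 negb_and -!lt0n m0.
pose E : 'M[R[i]]_n := (m%:R / n%:R) *: P.
have c0 : m%:R / n%:R != 0 :> R[i] by rewrite mulf_neq0 ?invr_eq0 // nC.
have EE : E *m E = E.
  rewrite -scalemxAl -scalemxAr PP !scalerA; congr (_ *: _).
  by rewrite nC; field; rewrite m0C n0C.
have rE : \rank E = m by rewrite mxrank_scale_nz.
have rQ : \rank (1%:M - E) = d.
  apply/eqP; rewrite eqn_leq -(leq_add2l m) -(leq_add2l m d) mdn -{1 2}rE.
  apply/andP; split.
    by apply: mulmx0_rank_max; rewrite mulmxBr mulmx1 EE subrr.
  by have := mxrank_add E (1%:M - E); rewrite addrC subrK mxrank1.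
have r0 : n%:R / d%:R != 0 :> R[i] by rewrite mulf_neq0 ?invr_eq0 // nC.
apply: (@no_equiangular_projection _ n d
  ((m%:R / d%:R) ^+ 2 * (welch_angle R n m)%:C ^+ 2)
  ((n%:R / d%:R) *: (1%:M - E)) ddn d3).
- by rewrite mxrank_scale_nz.
- rewrite -scalemxAl -scalemxAr; congr (_ *: (_ *: _)).
  by rewrite mulmxBr mulmx1 mulmxBl mul1mx EE subrr subr0.
- move=> k; rewrite !mxE eqxx Pd mulr1n nC; field.
  by rewrite d0C n0C.
- move=> j k jk; rewrite -(Po j k jk) !mxE (eq_sym k) (negPf jk) mulr0n nC.
  field.
  by rewrite d0C n0C.
Qed.
End EquiangularFrames.

Local Open Scope complex_scope.

Theorem theorem4p3 (R : realType) :
  ~ (exists phi : 'I_8 -> 'cV[R[i]]_3, equiangular_frame phi) /\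
  ~ (exists phi : 'I_8 -> 'cV[R[i]]_5, equiangular_frame phi).
Proof.
split=> -[phi]; first exact: no_equiangular_frame.
exact: (@no_complementary_equiangular_frame R 8 5 3).
Qed.
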